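(* For every integer $n \ge 0$, let $$a(n) = \sum_{r=0}^n \frac{\operatorname{lcm}(n, n-1, n-2, \ldots, n-r+1)}{\operatorname{lcm}(1,2,3,\ldots,r)}.$$ Then $a(n) \equiv m(n) \pmod 2$ for all $n \ge 0$.
   Context: For a non-negative integer $k$, $s_2(k)$ denotes the number of ones in the binary expansion of $k$. Define $\bar{t}(k) = 1$ if $s_2(k)$ is even and $\bar{t}(k)=0$ if $s_2(k)$ is odd. The sequence $m(n)$, $n \ge 0$, is defined by $m(2k) = \bar{t}(k)$ and $m(2k+1) = 0$ for all $k \ge 0$. The least common multiple of the empty list is $1$, so the $r=0$ term of the sum is $1$; each term of the sum is an integer. The sequence $a(n)$ is OEIS A061297, indexed from $n=0$: $1,2,4,8,14,32,39,114,\ldots$. *)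

(* Defs.v *)
From mathcomp Require Import all_boot.

Set Implicit Arguments.
Unset Strict Implicit.
Unset Printing Implicit Defensive.

(* Binary digits of k at positions i >= k vanish, since k < 2 ^ k. *)
Definition s2 (k : nat) : nat := \sum_(i < k) odd (k %/ 2 ^ i).

Definition tbar (k : nat) : nat := if odd (s2 k) then 0 else 1.

Definition m (n : nat) : nat := if odd n then 0 else tbar n./2.

Definition lcm_down (n r : nat) : nat := \big[lcmn/1]_(i < r) (n - i).

Definition lcm_upto (r : nat) : nat := \big[lcmn/1]_(1 <= i < r.+1) i.

(* The quotient is exact for every r <= n: see lcm_upto_dvd_down. *)
Definition a (n : nat) : nat := \sum_(r < n.+1) lcm_down n r %/ lcm_upto r.

Lemma lcm_upto_dvd_down (n r : nat) : r <= n -> lcm_upto r %| lcm_down n r.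
Proof.
move=> le_rn; rewrite /lcm_upto big_nat.
apply: (big_ind (fun d => d %| lcm_down n r)) =>
  [|x y dx dy|i /andP[i_gt0 le_ir]]; first exact: dvd1n.
  by rewrite dvdn_lcm dx dy.
have lt_r : n %% i < r by apply: leq_trans (ltn_pmod n i_gt0) _.
rewrite /lcm_down (bigD1 (Ordinal lt_r)) //=.
apply: dvdn_trans (dvdn_lcml _ _).
by rewrite {1}(divn_eq n i) addnK dvdn_mull.
Qed.

(* Main.v *)
Require Import Defs.
From mathcomp Require Import all_boot zify.

Set Implicit Arguments.
Unset Strict Implicit.

(* For 2^e <= r < 2^(e+1) the 2-adic valuation of lcm(1, ..., r) is e, so the
   r-th term of a(n) is odd iff none of n, ..., n-r+1 is divisible by 2^(e+1),
   i.e. iff r <= n mod 2^(e+1). Such r exist in this dyadic block only if the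
   binary digit of n at position e is 1, and then there are n mod 2^e + 1 of
   them. This number is 1 for e = 0 and has the parity of n + 1 for e > 0; so,
   modulo 2 and apart from the term r = 0, the sum counts the ones in n when n
   is even, and only the last binary digit when n is odd. *)

Lemma biglcm_gt0 (I : eqType) (s : seq I) (F : I -> nat) :
  {in s, forall i, 0 < F i} -> 0 < \big[lcmn/1]_(i <- s) F i.
Proof.
move=> F_gt0; rewrite big_seq; elim/big_ind: _ => // x y x_gt0 y_gt0.
by rewrite lcmn_gt0 x_gt0.
Qed.

(** The valuation of an lcm is the maximum of the valuations. For [k = 0] the empty list would be a
    counterexample. *)
Lemma pfactor_dvdn_biglcm (p k : nat) (I : eqType) (s : seq I) (F : I -> nat) :
    prime p -> 0 < k -> {in s, forall i, 0 < F i} ->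
  (p ^ k %| \big[lcmn/1]_(i <- s) F i) = has (fun i => p ^ k %| F i) s.
Proof.
move=> p_pr k_gt0; elim: s => [|i s IHs] F_gt0.
  by rewrite big_nil pfactor_dvdn // logn1 leqNgt k_gt0.
have Fi_gt0 : 0 < F i by apply: F_gt0; rewrite mem_head.
have Fs_gt0 : {in s, forall j, 0 < F j}.
  by move=> j js; apply: F_gt0; rewrite inE js orbT.
have lcm_gt0 := biglcm_gt0 Fs_gt0.
rewrite /= -IHs // big_cons !pfactor_dvdn ?lcmn_gt0 ?Fi_gt0 //.
by rewrite logn_lcm // leq_max.
Qed.

Lemma lcm_upto_gt0 (r : nat) : 0 < lcm_upto r.
Proof. by apply: biglcm_gt0 => i; rewrite mem_index_iota => /andP[]. Qed.

Lemma lcm_down_gt0 (n r : nat) : r <= n -> 0 < lcm_down n r.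
Proof.
move=> le_rn; apply: biglcm_gt0 => i _.
by rewrite subn_gt0 (leq_trans (ltn_ord i)).
Qed.

Lemma logn_lcm_upto (p r : nat) :
  prime p -> 0 < r -> logn p (lcm_upto r) = trunc_log p r.
Proof.
move=> p_pr r_gt0; have p_gt1 := prime_gt1 p_pr.
have /andP[le_pr lt_rp] := trunc_log_bounds p_gt1 r_gt0.
have F_gt0 : {in index_iota 1 r.+1, forall i, 0 < i}.
  by move=> i; rewrite mem_index_iota => /andP[].
apply/eqP; rewrite eqn_leq; apply/andP; split.
  rewrite leqNgt -pfactor_dvdn ?lcm_upto_gt0 // pfactor_dvdn_biglcm //.
  apply/hasPn => i; rewrite mem_index_iota => /andP[i_gt0 lt_ir].
  by apply/negP => /(dvdn_leq i_gt0); lia.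
rewrite -pfactor_dvdn ?lcm_upto_gt0 //.
have [->|e_gt0] := posnP (trunc_log p r); first exact: dvd1n.
rewrite pfactor_dvdn_biglcm //; apply/hasP; exists (p ^ trunc_log p r) => //.
by rewrite mem_index_iota expn_gt0 prime_gt0.
Qed.

(** The largest multiple of [p ^ k] up to [n] is [n - n %% p ^ k], the factor of index
    [n %% p ^ k]. *)
Lemma pfactor_dvdn_lcm_down (p k n r : nat) :
    prime p -> 0 < k -> r <= n ->
  (p ^ k %| lcm_down n r) = (n %% p ^ k < r).
Proof.
move=> p_pr k_gt0 le_rn; rewrite pfactor_dvdn_biglcm //; last first.
  by move=> i _; rewrite subn_gt0 (leq_trans (ltn_ord i)).
apply/hasP/idP => [[i _ dvd_ni]|lt_nr].
  apply: leq_ltn_trans (ltn_ord i).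
  have le_in : i <= n by rewrite ltnW // (leq_trans (ltn_ord i)).
  move: dvd_ni; rewrite -eqn_mod_dvd // => /eqP ->.
  exact: leq_mod.
exists (Ordinal lt_nr); first exact: mem_index_enum.
by rewrite /= {1}(divn_eq n (p ^ k)) addnK dvdn_mull.
Qed.

Lemma odd_lcm_down_div (n r : nat) :
    0 < r <= n ->
  odd (lcm_down n r %/ lcm_upto r) = (r <= n %% 2 ^ (trunc_log 2 r).+1).
Proof.
move=> /andP[r_gt0 le_rn]; have dvd_lL := lcm_upto_dvd_down le_rn.
have L_gt0 := lcm_down_gt0 le_rn.
(* Both sides say that the quotient has 2-adic valuation 0. *)
rewrite leqNgt -pfactor_dvdn_lcm_down // pfactor_dvdn // -logn_lcm_upto //.
rewrite -subn_gt0 -logn_div // -pfactor_dvdn ?expn1 ?dvdn2 ?negbK //.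
by rewrite divn_gt0 ?lcm_upto_gt0 // dvdn_leq.
Qed.

Lemma sum_nat_leq (m n q : nat) :
  q < n -> \sum_(m <= r < n) (r <= q) = q.+1 - m.
Proof.
elim: n => // n IHn lt_qn; have [le_mn|lt_nm] := leqP m n; last first.
  by rewrite big_geq //; lia.
rewrite big_nat_recr //=; have [lt|le_nq] := ltnP q n.
  by rewrite IHn //; lia.
have -> : q = n by lia.
under eq_big_nat => i /andP[_ lt_in] do rewrite ltnW //.
by rewrite sum_nat_const_nat muln1 subSn // addn1.
Qed.

Lemma modn_expnS (n e : nat) :
  n %% 2 ^ e.+1 = odd (n %/ 2 ^ e) * 2 ^ e + n %% 2 ^ e.
Proof.
have /= e_gt0 : 0 < 2 ^ e by rewrite expn_gt0.
rewrite {1}(divn_eq n (2 ^ e)) -{1}(odd_double_half (n %/ 2 ^ e)) mulnDl.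
rewrite -muln2 -mulnA -expnS addnAC addnC modnMDl modn_small //.
have := ltn_pmod n e_gt0; rewrite expnS; case: odd; lia.
Qed.

Lemma sum_dyadic_block (n e : nat) :
  \sum_(2 ^ e <= r < 2 ^ e.+1) (r <= n %% 2 ^ (trunc_log 2 r).+1)
    = odd (n %/ 2 ^ e) * (n %% 2 ^ e).+1.
Proof.
under eq_big_nat => r r_e do rewrite (@trunc_log_eq 2 e r) //.
have e_gt0 : 0 < 2 ^ e by rewrite expn_gt0.
(* If the digit at position [e] is 0, the bound on [r] is below [2 ^ e] and the truncated
   subtraction gives 0. *)
rewrite sum_nat_leq ?ltn_pmod ?expn_gt0 // modn_expnS.
have := ltn_pmod n e_gt0; case: odd; lia.
Qed.

(** Block 0 contributes the last digit of [n]; block [i.+1] contributes digit [i] of [n./2], with a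
    multiplicity that is even when [n] is odd. *)
Lemma odd_sum_dyadic (n k : nat) :
  odd (\sum_(1 <= r < 2 ^ k.+1) (r <= n %% 2 ^ (trunc_log 2 r).+1))
    = odd n || odd (\sum_(i < k) odd (n./2 %/ 2 ^ i)).
Proof.
elim: k => [|k IHk].
  by rewrite (sum_dyadic_block n 0) big_ord0 divn1 modn1 muln1 orbF oddb.
rewrite (@big_cat_nat _ _ _ (2 ^ k.+1)) ?leq_pexp2l ?expn_gt0 //=.
rewrite oddD IHk sum_dyadic_block big_ord_recr /= !oddD oddM !oddb /= -divn2.
(* Reduction modulo the even number [2 ^ k.+1] keeps the parity of [n]. *)
rewrite -divnMA -expnS odd_mod //.
  by case: (odd n); rewrite ?andbF ?addbF ?andbT.
by rewrite expnS oddM.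
Qed.

Theorem lemma8 (n : nat) : a n = m n %[mod 2].
Proof.
(* Extending the sum to complete blocks adds only zero terms, since [n %% d <= n < r]; the exponent
   matches the range of [s2 n./2]. *)
have lt_n : n < 2 ^ n./2.+1.
  by have := ltn_expl n./2 (isT : 1 < 2); rewrite expnS; lia.
have sum_trunc : \sum_(1 <= r < n.+1) (r <= n %% 2 ^ (trunc_log 2 r).+1)
    = \sum_(1 <= r < 2 ^ n./2.+1) (r <= n %% 2 ^ (trunc_log 2 r).+1).
  rewrite [RHS](@big_cat_nat _ _ _ n.+1) //= [X in _ + X]big_nat.
  rewrite [X in _ + X]big1 ?addn0 // => r /andP[lt_nr _].
  by rewrite leqNgt (leq_ltn_trans (leq_mod _ _) lt_nr).
have odd_a : odd (a n) = ~~ (odd n || odd (s2 n./2)).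
  rewrite /s2 -odd_sum_dyadic -sum_trunc /a.
  rewrite -(big_mkord xpredT (fun r => lcm_down n r %/ lcm_upto r)).
  (* The term [r = 0] is 1, which accounts for the negation. *)
  rewrite big_nat_recl // /lcm_down big_ord0 /lcm_upto big_geq // divn1 /=.
  rewrite oddD /= big_add1 /=; congr (~~ _).
  rewrite !(big_morph odd oddD (erefl _)) [LHS]big_nat [RHS]big_nat.
  by apply: eq_bigr => r lt_rn; rewrite oddb odd_lcm_down_div.
rewrite !modn2 odd_a /m /tbar.
by case: (odd n); case: (odd (s2 _)).
Qed.
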